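(* Let $p$ be a prime. (1) Let $r$ and $s$ be positive integers with $r\ge s$, let $m\ge 1$ be an integer, and suppose $p^r>mp^s-m$. Then $\mathsf{EGZ}(p^r,p^s,m)\le p^r+mp^s-m$. (2) Let $s\ge 1$ and $u\ge 0$ be integers and let $t\ge p^u$ be an integer such that $p^s\mid\binom{t}{p^u}$. Then $\mathsf{EGZ}(t,p^s,p^u)\ge t+p^{s+u}-p^u$. Furthermore, if $t=p^r$ where $r>u$, then $\mathsf{EGZ}(p^r,p^s,p^u)\ge p^r+p^{s+u}-p^u$. (3) Let $r,s,u$ be positive integers with $r\ge s+u$. Then $\mathsf{EGZ}(p^r,p^s,p^u)=p^r+p^{s+u}-p^u$.
   Context: A sequence $S$ over $\mathbb{Z}_k$ is a finite sequence of elements of $\mathbb{Z}_k$, order disregarded and repetition allowed (i.e. a finite multiset); its length $|S|$ is the number of its elements counted with multiplicity; a subsequence is a sub-multiset. For a positive integer $m$ and a sequence $S=(g_1,\dots,g_\ell)$ over $\mathbb{Z}_k$, $$e_m(S)=\sum_{1\le i_1<\cdots<i_m\le \ell}\ \prod_{j=1}^m g_{i_j}$$ computed in the ring $\mathbb{Z}_k$ (an empty sum is $0$). $\mathsf{EGZ}(t,k,m)$ denotes the smallest positive integer $z$ such that every sequence $S$ over $\mathbb{Z}_k$ of length $|S|\ge z$ contains a subsequence $S'$ of length exactly $t$ with $e_m(S')=0$; if no such $z$ exists, $\mathsf{EGZ}(t,k,m)=\infty$. *)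

(* Defs.v *)
From mathcomp Require Import all_boot all_order all_algebra.
From mathcomp Require Import boolp.
From mathcomp Require Export constructive_ereal.

Set Implicit Arguments.
Unset Strict Implicit.
Unset Printing Implicit Defensive.

Import GRing.Theory.

(* The index tuples i_1 < ... < i_m are encoded as the m-element sets of
   positions of S. *)
Definition esym (R : comNzRingType) (m : nat) (S : seq R) : R :=
  (\sum_(A : {set 'I_(size S)} | #|A| == m) \prod_(i in A) S`_i)%R.

(* Multisets over Z_k are represented by lists.  Up to reordering, the
   sub-multisets of S are exactly the lists S' with [subseq S' S]
   (cf. [count_subseqP]), and [esym m] does not depend on the order.
   Pitfall: ['Z_k] is the ring of integers mod k only for k >= 2. *)
Definition EGZ_bound (t k m z : nat) : Prop :=
  forall S : seq 'Z_k, z <= size S ->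
    exists S' : seq 'Z_k,
      [/\ subseq S' S, size S' = t & esym m S' = 0%R].

(* Values are extended integers, so that the infinite case is [+oo]. *)
Definition EGZ (t k m : nat) : \bar int :=
  if pselect (exists z, (0 < z) && `[< EGZ_bound t k m z >]) is left ex
  then (Posz (ex_minn ex))%:E else +oo%E.

(* Main.v *)
Require Import Defs.
From mathcomp Require Import all_boot all_order all_algebra.
From mathcomp Require Import boolp zify ring.

Set Implicit Arguments.
Unset Strict Implicit.
Unset Printing Implicit Defensive.

Import Order.TTheory GRing.Theory.

(** Upper bound: lift the terms of S to natural numbers and regard e_m as a
    polynomial of degree m in the indicators of the positions.  Since p^s
    divides y as soon as p does not divide 'C(y + p^s - 1, p^s - 1), the product
    of this binomial at y = e_m(A) with its analogue for #|A| and p^r detects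
    mod p the wanted sets A of positions.  Its degree is less than the length
    of S, so its alternating sum over all A vanishes, whereas the empty set
    contributes 1.

    Lower bound: p^(s+u) - 1 ones and t - p^u zeros.  A subsequence of length t
    with j ones has p^u <= j < p^(s+u), and then e_(p^u) = 'C(j, p^u) has p-adic
    valuation that of j %/ p^u, which is less than s. *)

(** * The [p]-adic valuation of binomial coefficients *)

Lemma ltn_logn_pexp p u b : prime p -> 0 < b < p ^ u -> logn p b < u.
Proof.
move=> p_pr /andP[b_gt0 ltb]; rewrite -(ltn_exp2l _ _ (prime_gt1 p_pr)).
by apply: leq_ltn_trans ltb; apply/dvdn_leq/pfactor_dvdnn.
Qed.

(** The gcd with [p ^ u] truncates valuations at [u], and that of [b] is below [u], so nothing is
    lost by truncation. *)
Lemma logn_eq_gcd_pexp p u a b : prime p -> 0 < a -> 0 < b < p ^ u ->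
  gcdn (p ^ u) a = gcdn (p ^ u) b -> logn p a = logn p b.
Proof.
move=> p_pr a_gt0 b_bnd /(congr1 (logn p)); have := ltn_logn_pexp p_pr b_bnd.
case/andP: b_bnd => b_gt0 _; have pu_gt0 : 0 < p ^ u by rewrite expn_gt0 prime_gt0.
by rewrite (logn_gcd _ pu_gt0 a_gt0) (logn_gcd _ pu_gt0 b_gt0) (pfactorK _ p_pr); lia.
Qed.

Lemma logn_MD_pexp p u a b :
  prime p -> 0 < b < p ^ u -> logn p (a * p ^ u + b) = logn p b.
Proof.
move=> p_pr b_bnd; apply: (logn_eq_gcd_pexp p_pr _ b_bnd (gcdnMDl _ _ _)); lia.
Qed.

Lemma logn_B_pexp p u b :
  prime p -> 0 < b < p ^ u -> logn p (p ^ u - b) = logn p b.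
Proof.
move=> p_pr b_bnd; have [b_gt0 ltb] := andP b_bnd.
apply: (logn_eq_gcd_pexp p_pr _ b_bnd); first by rewrite subn_gt0.
have := gcdnDr b (p ^ u - b); have := gcdnDl (p ^ u - b) b.
by rewrite subnK 1?ltnW // gcdnC [gcdn _ b]gcdnC [gcdn b (p ^ u)]gcdnC => -> ->.
Qed.

(** With N = h p^u - 1, (k+1) C(N, k+1) = (N-k) C(N, k); here N - k = h p^u - (k+1) and k + 1 have
    equal valuations, so induction on [k] applies. *)
Lemma logn_bin_pred p u h k :
  prime p -> 0 < h -> k < p ^ u -> logn p 'C((h * p ^ u).-1, k) = 0.
Proof.
move=> p_pr h_gt0; have pu_gt0 : 0 < p ^ u by rewrite expn_gt0 prime_gt0.
have hE : h * p ^ u = h.-1 * p ^ u + p ^ u by rewrite -mulSnr prednK.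
elim: k => [|k IHk] ltk; first by rewrite bin0 logn1.
have := congr1 (logn p) (mul_bin_left (h * p ^ u).-1 k).
rewrite !lognM ?bin_gt0 ?IHk //; try lia.
have -> : (h * p ^ u).-1 - k = h.-1 * p ^ u + (p ^ u - k.+1).
  by rewrite addnBA 1?ltnW // -hE -subn1 -subnDA add1n.
by rewrite addn0 logn_MD_pexp ?logn_B_pexp //; lia.
Qed.

(** Induction on the remainder [l] of [n] modulo [p ^ u]. For l = 0, C(h p^u, p^u) = h C(h p^u - 1,
    p^u - 1), and the last factor is prime to [p]. In the step, n C(n-1, p^u) = (n - p^u) C(n, p^u),
    where [n] and [n - p ^ u] share the valuation of [l.+1]. *)
Lemma logn_bin_pexp p u n :
  prime p -> p ^ u <= n -> logn p 'C(n, p ^ u) = logn p (n %/ p ^ u).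
Proof.
move=> p_pr le_n; have pu_gt0 : 0 < p ^ u by rewrite expn_gt0 prime_gt0.
have h_gt0 : 0 < n %/ p ^ u by rewrite divn_gt0.
have := divn_eq n (p ^ u); have := ltn_pmod n pu_gt0.
move: (n %/ p ^ u) (n %% p ^ u) h_gt0 => h l h_gt0 + ->.
elim: l => [_|l IHl ltl].
  rewrite addn0; have := mul_bin_diag (h * p ^ u) (p ^ u).-1.
  rewrite prednK // [p ^ u * _]mulnC mulnAC => /eqP.
  rewrite eqn_pmul2r // => /eqP <-.
  by rewrite lognM ?logn_bin_pred ?addn0 ?bin_gt0 //; nia.
have := congr1 (logn p) (mul_bin_down (h * p ^ u + l.+1) (p ^ u)).
have -> : h * p ^ u + l.+1 - p ^ u = h.-1 * p ^ u + l.+1.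
  by rewrite -{1}(prednK h_gt0) mulSnr addnAC addnK.
rewrite addnS /= lognM ?bin_gt0 //; [|nia].
have le_hl : p ^ u <= h * p ^ u + l.+1.
  exact: leq_trans (leq_pmull _ h_gt0) (leq_addr _ _).
rewrite lognM ?bin_gt0 -?addnS ?logn_MD_pexp ?IHl ?le_hl ?addn_gt0 ?orbT //.
  by move/addnI.
exact: ltnW.
Qed.

Lemma dvdn_bin_pexp_modn p s u n :
  prime p -> p ^ u <= n -> p ^ s %| 'C(n, p ^ u) -> n %% p ^ (s + u) < p ^ u.
Proof.
move=> p_pr le_n; have pu_gt0 : 0 < p ^ u by rewrite expn_gt0 prime_gt0.
rewrite pfactor_dvdn ?bin_gt0 // logn_bin_pexp // -pfactor_dvdn ?divn_gt0 //.
case/dvdnP => h hE; rewrite (divn_eq n (p ^ u)) hE -mulnA -expnD.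
rewrite modnMDl; apply: leq_ltn_trans (leq_mod _ _) _; exact: ltn_pmod.
Qed.

(** As (y+q) C(y+q-1, q-1) = q C(y+q, q), [q] divides the left side, and the coprime binomial
    cancels. *)
Lemma dvdn_of_coprime_bin q y :
  0 < q -> coprime q 'C(y + q.-1, q.-1) -> q %| y.
Proof.
move=> q_gt0 co; have := mul_bin_diag (y + q) q.-1.
rewrite prednK // -{2}(prednK q_gt0) addnS /= => E.
have : q %| (y + q) * 'C(y + q.-1, q.-1) by rewrite E dvdn_mulr.
by rewrite Gauss_dvdl // dvdn_addl.
Qed.

Local Open Scope ring_scope.

(** * Integer polynomials on the vertices of a cube *)

Section CubePolynomials.

Variable T : finType.

(* Restrictions to the vertices of the cube {0,1}^T, identified with the
   subsets of T, of the integer polynomials of degree at most d in variables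
   indexed by T: squarefree monomials become the indicators of U \subset A. *)
Inductive cube_poly (d : nat) : ({set T} -> int) -> Prop :=
| CubeMonomial (U : {set T}) of (#|U| <= d)%N : cube_poly d (fun A => (U \subset A)%:R)
| CubeZero : cube_poly d (fun=> 0)
| CubeLinear c f g of cube_poly d f & cube_poly d g :
    cube_poly d (fun A => c * f A + g A).

Lemma cube_poly_const d c : cube_poly d (fun=> c).
Proof.
have := CubeLinear c (@CubeMonomial d set0 _) (CubeZero d).
rewrite cards0 => /(_ isT); congr cube_poly; apply/funext => A.
by rewrite sub0set mulr1 addr0.
Qed.

Lemma cube_polyD d f g :
  cube_poly d f -> cube_poly d g -> cube_poly d (fun A => f A + g A).
Proof.
move=> fP gP; have := CubeLinear 1 fP gP.
by congr cube_poly; apply/funext => A; rewrite mul1r.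
Qed.

Lemma cube_polyM d e f g :
  cube_poly d f -> cube_poly e g -> cube_poly (d + e) (fun A => f A * g A).
Proof.
move=> fP gP; elim: fP => [U leU||c f1 f2 _ IH1 _ IH2].
- elim: gP => [V leV||c g1 g2 _ IH1 _ IH2].
  + have le : (#|U :|: V| <= d + e)%N.
      exact: leq_trans (leq_card_setU _ _) (leq_add leU leV).
    have := CubeMonomial le; congr cube_poly; apply/funext => A.
    by rewrite subUset -natrM mulnb.
  + by have := CubeZero (d + e); congr cube_poly; apply/funext => A; rewrite mulr0.
  + have := CubeLinear c IH1 IH2; congr cube_poly; apply/funext => A.
    by rewrite mulrDr mulrCA.
- by have := CubeZero (d + e); congr cube_poly; apply/funext => A; rewrite mul0r.
- have := CubeLinear c IH1 IH2; congr cube_poly; apply/funext => A.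
  by rewrite mulrDl mulrA.
Qed.

Lemma cube_poly_sum (I : finType) (P : pred I) d (F : I -> {set T} -> int) :
  (forall i, P i -> cube_poly d (F i)) ->
  cube_poly d (fun A => \sum_(i | P i) F i A).
Proof.
move=> FP; elim: (index_enum I) => [|i r IHr].
  by have := CubeZero d; congr cube_poly; apply/funext => A; rewrite big_nil.
have [Pi|/negbTE nPi] := boolP (P i).
  have := cube_polyD (FP i Pi) IHr; congr cube_poly; apply/funext => A.
  by rewrite big_cons Pi.
by move: IHr; congr cube_poly; apply/funext => A; rewrite big_cons nPi.
Qed.

Lemma cube_poly_prod k d (F : 'I_k -> {set T} -> int) :
  (forall i, cube_poly d (F i)) ->
  cube_poly (k * d) (fun A => \prod_(i < k) F i A).
Proof.
elim: k F => [|k IHk] F FP.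
  have := cube_poly_const (0 * d) 1; congr cube_poly; apply/funext => A.
  by rewrite big_ord0.
rewrite mulSn; have := cube_polyM (FP ord0) (IHk (fun i => F (lift ord0 i)) _).
move=> /(_ (fun i => FP _)); congr cube_poly; apply/funext => A.
by rewrite big_ord_recl.
Qed.

(** A product of [k] factors e + (k-i). Falling factorials replace binomials here to keep the
    coefficients integral. *)
Lemma cube_poly_ffact k d (e : {set T} -> nat) :
  cube_poly d (fun A => (e A)%:Z) ->
  cube_poly (k * d) (fun A => ((e A + k) ^_ k)%N%:Z).
Proof.
move=> eP.
have := @cube_poly_prod k d (fun i A => (e A)%:Z + (k - i)%N%:Z).
move=> /(_ (fun i => cube_polyD eP (cube_poly_const _ _))).
congr cube_poly; apply/funext => A.
rewrite ffact_prod (big_morph Posz PoszM (erefl 1%:Z)); apply: eq_bigr => i _.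
by rewrite -PoszD addnBA // ltnW.
Qed.

Lemma cube_poly_alternating_sum d f :
  cube_poly d f -> (d < #|T|)%N -> \sum_(A : {set T}) (-1) ^+ #|A| * f A = 0.
Proof.
move=> fP ltd; elim: fP => [U leU||c f1 f2 _ IH1 _ IH2].
- have [x xU] : exists x, x \notin U.
    apply/existsP; rewrite -negb_forall; apply: contraL ltd => /forallP UT.
    rewrite -leqNgt; apply: leq_trans leU; apply/subset_leq_card/subsetP => x _.
    exact: UT.
  (* In the expansion over [A], elements of [A] contribute -1 and the others the indicator of
     [i \notin U], whose product is that of [U \subset A]. The factor at [x] is zero. *)
  transitivity (\prod_(i : T) (-1 + (i \notin U)%:R) : int); last first.
    by rewrite (bigD1 x) //= xU addNr mul0r.
  rewrite bigA_distr; apply: eq_bigr => A _.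
  rewrite (bigID (mem A)) /=; congr (_ * _).
    rewrite (eq_bigr (fun=> -1)) ?prodr_const //; first by move=> i ->.
  have [UA|/subsetPn[y yU yA]] := boolP (U \subset A).
    rewrite big1 // => i iA; rewrite (negbTE iA).
    by rewrite (contra (subsetP UA i) iA).
  by rewrite (bigD1 y) //= (negbTE yA) yU mul0r.
- by rewrite big1 // => A _; rewrite mulr0.
- rewrite (eq_bigr (fun A : {set T} =>
    c * ((-1) ^+ #|A| * f1 A) + (-1) ^+ #|A| * f2 A)).
    by rewrite big_split /= -big_distrr /= IH1 IH2 mulr0 addr0.
  by move=> A _; rewrite mulrDr mulrCA.
Qed.

Lemma cube_poly_card : cube_poly 1 (fun A => (#|A|)%:Z).
Proof.
have := @cube_poly_sum T predT 1 (fun x A => ([set x] \subset A)%:R).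
move=> /(_ (fun x _ => CubeMonomial (eq_leq (cards1 x)))).
congr cube_poly; apply/funext => A.
rewrite (eq_bigr (fun x => (x \in A)%:R)); last by move=> x _; rewrite sub1set.
by rewrite -natr_sum natz -sum1_card [in RHS]big_mkcond.
Qed.

(** The lower bound on [#|T|] is the degree of the detecting product; the upper one leaves [p ^ r]
    as the only nonzero size divisible by [p ^ r]. *)
Lemma exists_set_dvdn p r s d (e : {set T} -> nat) :
  prime p -> cube_poly d (fun A => (e A)%:Z) -> e set0 = 0 ->
  ((p ^ s).-1 * d + (p ^ r).-1 < #|T| < 2 * p ^ r)%N ->
  exists A : {set T}, #|A| = (p ^ r)%N /\ (p ^ s %| e A)%N.
Proof.
move=> p_pr eP e0 /andP[ltT Tlt]; apply: contrapT => noA.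
have p_gt0 := prime_gt0 p_pr.
pose F A := 'C(e A + (p ^ s).-1, (p ^ s).-1).
pose G (A : {set T}) := 'C(#|A| + (p ^ r).-1, (p ^ r).-1).
have pFG A : A != set0 -> (p %| F A * G A)%N.
  move=> A0; apply: contra_notT noA => pN; exists A.
  have [pF pG] : coprime p (F A) /\ coprime p (G A).
    by apply/andP; rewrite -coprimeMr prime_coprime.
  split; last by apply: dvdn_of_coprime_bin; rewrite ?expn_gt0 ?p_gt0 ?coprimeXl.
  have /dvdnP[[|[|k]] kE] : (p ^ r %| #|A|)%N.
    by apply: dvdn_of_coprime_bin; rewrite ?expn_gt0 ?p_gt0 ?coprimeXl.
  - by move: A0; rewrite -cards_eq0 kE.
  - by rewrite kE mul1n.
  - by have := max_card (mem A); rewrite kE; nia.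
have := cube_poly_alternating_sum (cube_polyM (cube_poly_ffact (p ^ s).-1 eP)
  (cube_poly_ffact (p ^ r).-1 cube_poly_card)).
rewrite muln1 => /(_ ltT).
(* The nonzero ratio between the falling factorials and the binomials in [F] and [G]. *)
pose c : int := (((p ^ s).-1)`! * ((p ^ r).-1)`!)%N.
rewrite (eq_bigr (fun A : {set T} =>
  c * ((-1) ^+ #|A| * (F A * G A)%N%:Z))); last first.
  move=> A _; rewrite -!bin_ffact !PoszM /F /G /c; ring.
rewrite -big_distrr /= => /eqP; rewrite mulf_eq0 => /orP[/eqP cE|/eqP].
  have : (0 < ((p ^ s).-1)`! * ((p ^ r).-1)`!)%N by rewrite muln_gt0 !fact_gt0.
  by case: cE => ->.
(* The empty set contributes 1 and every other term is divisible by [p], so [p] would divide 1. *)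
rewrite (bigD1 set0) //= cards0 expr0 mul1r /F /G e0 cards0 !add0n !binn.
move/eqP; rewrite addr_eq0 => /eqP E.
have : (p %| 1%:Z)%Z.
  rewrite E rpredN; apply: rpred_sum => A A0.
  by apply: dvdz_mull; apply: pFG.
by rewrite dvdzE /= dvdn1 => /eqP p1; rewrite p1 in p_pr.
Qed.

End CubePolynomials.

(** * Elementary symmetric functions as coefficients of a product *)

Lemma coef_prod_scaleX_D1 (R : comNzRingType) (I : finType) (F : I -> R) m :
  (\prod_i (F i *: 'X + 1))`_m = \sum_(B : {set I} | #|B| == m) \prod_(i in B) F i.
Proof.
rewrite bigA_distr coef_sum [RHS]big_mkcond; apply: eq_bigr => B _.
rewrite -big_mkcond /= (eq_bigr (fun i => (F i)%:P * 'X)); last first.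
  by move=> i _; rewrite mul_polyC.
rewrite big_split /= prodr_const -rmorph_prod coefCM coefXn eq_sym.
by case: eqP; rewrite ?mulr1 ?mulr0.
Qed.

Lemma esym_coef (R : comNzRingType) m (S : seq R) :
  Defs.esym m S = (\prod_(x <- S) (x *: 'X + 1))`_m.
Proof. by rewrite (big_nth 0) big_mkord coef_prod_scaleX_D1. Qed.

(** Keeping all of [I] as index set, with the values outside [A] replaced by 0, shows the dependence
    on [A] as a combination of monomials. *)
Lemma esym_map_enum (R : comNzRingType) (I : finType) (F : I -> R) m (A : {set I}) :
  Defs.esym m [seq F i | i <- enum A] =
  \sum_(B : {set I} | #|B| == m) (\prod_(i in B) F i) *+ (B \subset A).
Proof.
rewrite esym_coef big_map big_enum big_mkcond /=.
rewrite (eq_bigr (fun i => (F i *+ (i \in A)) *: 'X + 1)); last first.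
  by move=> i _; case: (i \in A); rewrite ?scale0r ?add0r.
rewrite coef_prod_scaleX_D1; apply: eq_bigr => B _.
have [BA|/subsetPn[x xB xA]] := boolP (B \subset A).
  by apply: eq_bigr => i iB; rewrite (subsetP BA).
by rewrite (bigD1 x) //= (negbTE xA) mul0r.
Qed.

Lemma subseq_map_enum (R : eqType) (x0 : R) (S : seq R) (A : {set 'I_(size S)}) :
  subseq [seq nth x0 S i | i : 'I_(size S) <- enum A] S.
Proof.
have E : S = [seq nth x0 S i | i : 'I_(size S) <- enum 'I_(size S)].
  by rewrite -[LHS](mkseq_nth x0) /mkseq -val_enum_ord -map_comp.
by rewrite [X in subseq _ X]E; apply: map_subseq; rewrite enumT; apply: filter_subseq.
Qed.

Lemma coef_XD1_exp (R : comNzRingType) n m :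
  (('X + 1 : {poly R}) ^+ n)`_m = 'C(n, m)%:R.
Proof.
elim: n m => [|n IHn] [|m]; rewrite ?expr0 ?coef1 //.
  by rewrite exprS mulrDl mul1r coefD coefXM IHn !bin0 add0r.
by rewrite exprS mulrDl mul1r coefD coefXM !IHn binS natrD addrC.
Qed.

(** Zeros contribute the factor 1 to the generating product and ones the factor X + 1. *)
Lemma esym_binary (R : comNzRingType) m (S : seq R) :
  all [in [:: 1; 0]] S -> Defs.esym m S = 'C(count_mem 1 S, m)%:R.
Proof.
rewrite esym_coef -coef_XD1_exp => S01.
suff -> : \prod_(x <- S) (x *: 'X + 1) = ('X + 1) ^+ count_mem 1 S by [].
elim: S S01 => [|x S IHS] /=; first by rewrite big_nil.
rewrite big_cons => /andP[x01 /IHS ->]; rewrite exprD; congr (_ * _).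
have /orP[/eqP ->|/eqP ->] : (x == 1) || (x == 0) by rewrite !inE in x01.
  by rewrite eqxx scale1r.
by rewrite eq_sym oner_eq0 scale0r add0r.
Qed.

(** * Upper and lower bounds for [EGZ] *)

Lemma natr_Zp_eq0 k n : (1 < k)%N -> (n%:R == 0 :> 'Z_k) = (k %| n)%N.
Proof. by move=> k_gt1; rewrite -val_eqE /= val_Zp_nat. Qed.

Lemma EGZ_le t k m z :
  (0 < z)%N -> EGZ_bound t k m z -> (EGZ t k m <= (Posz z)%:E)%E.
Proof.
move=> z_gt0 zP; rewrite /EGZ; case: pselect => [ex|[]]; last first.
  by exists z; rewrite z_gt0; apply/asboolP.
case: ex_minnP => n _ /(_ z); rewrite z_gt0 lee_fin lez_nat; apply.
exact/asboolP.
Qed.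

Lemma EGZ_ge t k m z :
  (forall n, EGZ_bound t k m n -> (z <= n)%N) -> ((Posz z)%:E <= EGZ t k m)%E.
Proof.
move=> zP; rewrite /EGZ; case: pselect => [ex|_]; last exact: leey.
by case: ex_minnP => n /andP[_ /asboolP /zP]; rewrite lee_fin lez_nat.
Qed.

Lemma EGZ_ge_binary k t m lo hi : (1 < k)%N -> (lo <= t)%N -> (0 < hi)%N ->
  (forall j, (lo <= j < hi)%N -> (j <= t)%N -> ~~ (k %| 'C(j, m))%N) ->
  ((Posz (t - lo + hi))%:E <= EGZ t k m)%E.
Proof.
move=> k_gt1 lo_t hi_gt0 ndv; apply: EGZ_ge => n nP; rewrite leqNgt; apply/negP => ltn.
(* One term short of the claimed bound. With only [t - lo] zeros available, a subsequence of length
   [t] has at least [lo] ones, and fewer than [hi]. *)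
pose S : seq 'Z_k := nseq hi.-1 1 ++ nseq (t - lo) 0.
have [|S' [sS' szS' /eqP]] := nP S; first by rewrite size_cat !size_nseq; lia.
have S01 : all [in [:: 1; 0]] S by rewrite all_cat !all_nseq !inE !eqxx !orbT.
have S'01 : all [in [:: 1; 0]] S'.
  by apply/allP => x /(mem_subseq sS'); apply: allP S01 x.
rewrite esym_binary // natr_Zp_eq0 //; apply/negP.
have le1 := leq_count_subseq (pred1 1) sS'.
have le0 := leq_count_subseq (pred1 0) sS'.
move: le1 le0; rewrite !count_cat !count_nseq /=.
rewrite !mul1n !mul0n addn0 add0n => le1 le0.
have E : (count_mem 1%R S' + count_mem 0%R S' = t)%N.
  rewrite -szS' -(count_predC (pred1 (1 : 'Z_k))); congr addn.
  apply: eq_in_count => x /(allP S'01).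
  by rewrite !inE => /orP[]/eqP ->.
move: (count_mem 1 S') (count_mem 0 S') le1 le0 E => c1 c0 le1 le0 E.
by apply: ndv; lia.
Qed.

Lemma cube_poly_sum_prod (I : finType) (w : I -> nat) m :
  cube_poly m (fun A => (\sum_(B : {set I} | #|B| == m)
                          (\prod_(i in B) w i) * (B \subset A))%N%:Z).
Proof.
have := @cube_poly_sum I _ (fun B : {set I} => #|B| == m) m
  (fun B A => (\prod_(i in B) w i)%N%:Z * (B \subset A)%:R + 0).
move=> /(_ (fun B sB => CubeLinear _ (CubeMonomial (eq_leq (eqP sB))) (CubeZero _ _))).
congr cube_poly; apply/funext => A.
rewrite (big_morph Posz PoszD (erefl 0%:Z)); apply: eq_bigr => B _.
by rewrite addr0 PoszM natz.
Qed.

Lemma EGZ_bound_pexp p r s m :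
  prime p -> (0 < s)%N -> (0 < m)%N -> (m * p ^ s - m < p ^ r)%N ->
  EGZ_bound (p ^ r) (p ^ s) m (p ^ r + m * p ^ s - m).
Proof.
move=> p_pr s_gt0 m_gt0 lt_r S0 le_S0.
have k_gt1 : (1 < p ^ s)%N by rewrite -{1}(exp1n s) ltn_exp2r ?prime_gt1.
have Q_gt0 : (0 < p ^ r)%N by rewrite expn_gt0 prime_gt0.
(* Truncation to length exactly [z] gives a size below 2 p^r, by [lt_r]. *)
set z := (_ - m)%N in le_S0; pose S := take z S0.
have szS : size S = z by rewrite size_take_min; apply/minn_idPl.
pose F (i : 'I_(size S)) := S`_i.
pose e (A : {set 'I_(size S)}) := (\sum_(B : {set 'I_(size S)} | #|B| == m)
  (\prod_(i in B) (F i : nat)) * (B \subset A))%N.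
have [||A [cardA dvA]] := @exists_set_dvdn _ p r s m e p_pr (cube_poly_sum_prod _ _).
(* Since m > 0, no [B] of size [m] lies in the empty set. *)
- rewrite /e big1 // => B sB; rewrite subset0 -cards_eq0 (eqP sB).
  by rewrite eqn0Ngt m_gt0 muln0.
(* The degree (p^s - 1) m + p^r - 1 equals z - 1. *)
- rewrite card_ord szS /z; nia.
exists [seq F i | i <- enum A]; split.
- exact: subseq_trans (subseq_map_enum _ _) (take_subseq _ _).
- by rewrite size_map -cardE.
rewrite esym_map_enum; transitivity ((e A)%:R : 'Z_(p ^ s)).
  rewrite natr_sum; apply: eq_bigr => B _; rewrite natrM natr_prod mulr_natr.
  by congr (_ *+ _); apply: eq_bigr => i _; rewrite natr_Zp.
by apply/eqP; rewrite natr_Zp_eq0.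
Qed.

Lemma EGZ_ge_pexp p s u t : prime p -> (0 < s)%N -> (p ^ u <= t)%N ->
  ((Posz (t + p ^ (s + u) - p ^ u))%:E <= EGZ t (p ^ s) (p ^ u))%E.
Proof.
move=> p_pr s_gt0 le_t.
have k_gt1 : (1 < p ^ s)%N by rewrite -{1}(exp1n s) ltn_exp2r ?prime_gt1.
rewrite -addnBAC //; apply: EGZ_ge_binary => //.
  by rewrite expn_gt0 prime_gt0.
(* For j < p^(s+u) the remainder modulo [p ^ (s + u)] is [j] itself, which is at least [p ^ u]. *)
move=> j /andP[le_j lt_j] _; apply/negP => /(dvdn_bin_pexp_modn p_pr le_j).
by rewrite modn_small // ltnNge le_j.
Qed.

Local Close Scope ring_scope.

Theorem theorem2p20 (p : nat) (p_prime : prime p) :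
  [/\ (forall r s m : nat, 0 < r -> 0 < s -> s <= r -> 1 <= m ->
         m * p ^ s - m < p ^ r ->
         (EGZ (p ^ r) (p ^ s) m <= (Posz (p ^ r + m * p ^ s - m))%:E)%E),
      ((forall s u t : nat, 1 <= s -> p ^ u <= t ->
          p ^ s %| 'C(t, p ^ u) ->
          (EGZ t (p ^ s) (p ^ u) >= (Posz (t + p ^ (s + u) - p ^ u))%:E)%E)
       /\
       (forall s u r : nat, 1 <= s -> u < r ->
          (EGZ (p ^ r) (p ^ s) (p ^ u)
             >= (Posz (p ^ r + p ^ (s + u) - p ^ u))%:E)%E))
    & (forall r s u : nat, 0 < r -> 0 < s -> 0 < u -> s + u <= r ->
         EGZ (p ^ r) (p ^ s) (p ^ u)
           = (Posz (p ^ r + p ^ (s + u) - p ^ u))%:E)].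
Proof.
split=> [r s m _ s_gt0 _ m_gt0 lt_r||r s u _ s_gt0 _ le_r].
- apply: EGZ_le; last exact: EGZ_bound_pexp.
  have : m <= m * p ^ s by rewrite leq_pmulr // expn_gt0 prime_gt0.
  lia.
- split=> [s u t s_gt0 le_t _|s u r s_gt0 lt_r]; first exact: EGZ_ge_pexp.
  by apply: EGZ_ge_pexp; rewrite // leq_exp2l ?prime_gt1 // ltnW.
have pu_gt0 : 0 < p ^ u by rewrite expn_gt0 prime_gt0.
have le_pu : p ^ u <= p ^ r by rewrite leq_exp2l ?prime_gt1 //; lia.
apply/eqP; rewrite eq_le EGZ_ge_pexp // andbT [s + u]addnC expnD.
have le_ps : p ^ u <= p ^ u * p ^ s by rewrite leq_pmulr // expn_gt0 prime_gt0.
(* With m = p^u > 0, this gives m p^s - m < p^r, as the upper bound requires. *)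
have le_su : p ^ u * p ^ s <= p ^ r.
  by rewrite -expnD addnC leq_exp2l ?prime_gt1.
apply: EGZ_le; first by lia.
by apply: EGZ_bound_pexp => //; lia.
Qed.
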